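(* Let $R>0$ and $H\in\mathbb{R}$. A non-circular immersed curve $\gamma:\mathbb{R}\to\mathbb{C}$ generates a twizzler in $\mathbb{C}\times\mathbf{S}^1_R$ with mean curvature $h\equiv H$ if and only if for some constant $c\in\mathbb{R}$ it solves $$\frac{2\pi R^2\,(\dot\gamma\cdot \mathrm{i}\gamma)}{\sqrt{R^2|\dot\gamma|^2+(\dot\gamma\cdot\gamma)^2}}-\pi R H|\gamma|^2=c.$$
   Context: $\mathbf{S}^1_R$ is the circle of radius $R$, and $\mathbb{C}\times\mathbf{S}^1_R$ carries the product of the standard metrics and the standard orientation. The dot $a\cdot b$ on $\mathbb{C}\cong\mathbb{R}^2$ is the real Euclidean inner product, and $\dot\gamma$ is the derivative of $\gamma$. The circle group acts on $\mathbb{C}\times\mathbf{S}^1_R$ by screw motions $[e^{\mathrm{i}t}](z,Re^{\mathrm{i}\theta})=(e^{\mathrm{i}t}z,Re^{\mathrm{i}(t+\theta)})$. The surface generated by the immersed curve $\gamma$ is the surface invariant under this action parametrized by $$X(u,v)=\left(e^{\mathrm{i}v}\gamma(u),\,Re^{\mathrm{i}v}\right),$$ oriented so that the frame $\{X_u,X_v\}$ is positively oriented; its unit normal $\nu$ is the positive multiple of $X_u\wedge X_v$ (cross product), and its mean curvature is $h=\mathrm{div}_\Sigma(\nu)$, the trace of $\nabla\nu$ on the tangent plane (so a circular cylinder of radius $r$ with outward normal has $h=1/r$). A twizzler is such a helicoidal surface having constant mean curvature. ''Non-circular'' means that $\gamma$ does not merely trace (part of) a circle centered at the origin, i.e. that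 the generated surface is not (part of) a circular cylinder about the axis $\{0\}\times\mathbf{S}^1_R$. *)

(* Defs.v *)
From Stdlib Require Import Reals.
From Coquelicot Require Import Coquelicot.

Open Scope R_scope.

(* The radius of the circle factor is written [rho] throughout.  The ambient
   space C x S^1_rho is the set of p : C * C with Cmod (snd p) = rho, with the
   metric induced from C * C = R^4. *)

Definition expi (t : R) : C := (cos t, sin t).

Definition dot (a b : C) : R := Re a * Re b + Im a * Im b.

Definition inner (a b : C * C) : R := dot (fst a) (fst b) + dot (snd a) (snd b).

Definition scal2 (k : R) (a : C * C) : C * C :=
  ((RtoC k * fst a)%C, (RtoC k * snd a)%C).

Definition deriv (f : R -> C) (t : R) : C :=
  (Derive (fun s => Re (f s)) t, Derive (fun s => Im (f s)) t).

Definition pd_u (F : R -> R -> C * C) (u v : R) : C * C :=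
  (deriv (fun s => fst (F s v)) u, deriv (fun s => snd (F s v)) u).

Definition pd_v (F : R -> R -> C * C) (u v : R) : C * C :=
  (deriv (fun s => fst (F u s)) v, deriv (fun s => snd (F u s)) v).

(* [Derive] is total, so differentiability of every lower-order derivative
   has to be required explicitly. *)
Definition of_class_C2 (f : R -> R) : Prop :=
  forall t : R,
    (forall k : nat, (k <= 2)%nat -> ex_derive_n f k t) /\
    continuous (Derive_n f 2) t.

Definition immersed (gamma : R -> C) : Prop :=
  of_class_C2 (fun t => Re (gamma t)) /\
  of_class_C2 (fun t => Im (gamma t)) /\
  (forall t : R, deriv gamma t <> RtoC 0).

Definition circular (gamma : R -> C) : Prop :=
  exists r : R, forall t : R, Cmod (gamma t) = r.

(* At p, the vectors (1, 0), (i, 0), (0, circle_tangent rho p) form a positive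
   orthonormal basis of the tangent space of C x S^1_rho. *)
Definition circle_tangent (rho : R) (p : C * C) : C := (Ci * snd p / RtoC rho)%C.

(* Cross product of the tangent vectors a and b at p, computed in that basis. *)
Definition cross (rho : R) (p a b : C * C) : C * C :=
  let a1 := Re (fst a) in
  let a2 := Im (fst a) in
  let a3 := dot (snd a) (circle_tangent rho p) in
  let b1 := Re (fst b) in
  let b2 := Im (fst b) in
  let b3 := dot (snd b) (circle_tangent rho p) in
  ((a2 * b3 - a3 * b2, a3 * b1 - a1 * b3),
   (RtoC (a1 * b2 - a2 * b1) * circle_tangent rho p)%C).

Definition unit_normal (rho : R) (X : R -> R -> C * C) (u v : R) : C * C :=
  let N := cross rho (X u v) (pd_u X u v) (pd_v X u v) in
  scal2 (/ sqrt (inner N N)) N.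

(* The trace over the tangent plane of the covariant derivative of the unit
   normal nu: the sum over i, j of g^ij <nabla_i nu, X_j>, with (g^ij) the
   inverse of the first fundamental form (E, F; F, G).  The covariant
   derivative of C x S^1_rho is the tangential part of the derivative in
   C * C, so the inner products with X_u and X_v may be taken with the
   latter. *)
Definition mean_curvature (rho : R) (X : R -> R -> C * C) (u v : R) : R :=
  let Xu := pd_u X u v in
  let Xv := pd_v X u v in
  let nu_u := pd_u (unit_normal rho X) u v in
  let nu_v := pd_v (unit_normal rho X) u v in
  let E := inner Xu Xu in
  let F := inner Xu Xv in
  let G := inner Xv Xv in
  (G * inner nu_u Xu - F * (inner nu_u Xv + inner nu_v Xu) + E * inner nu_v Xv)
  / (E * G - F ^ 2).

Definition screw (t : R) (p : C * C) : C * C :=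
  ((expi t * fst p)%C, (expi t * snd p)%C).

(* Inclusion of each moved surface suffices for invariance, since the screw
   motions form a group. *)
Definition helicoidal (rho : R) (X : R -> R -> C * C) : Prop :=
  (forall u v : R, Cmod (snd (X u v)) = rho) /\
  (forall t u v : R, exists u' v' : R, screw t (X u v) = X u' v').

Definition twizzler (rho H : R) (X : R -> R -> C * C) : Prop :=
  helicoidal rho X /\ (forall u v : R, mean_curvature rho X u v = H).

Definition generated_surface (rho : R) (gamma : R -> C) (u v : R) : C * C :=
  ((expi v * gamma u)%C, (RtoC rho * expi v)%C).

(* Main.v *)
(* Write p = gamma' . gamma, q = gamma' . i gamma, k = gamma'' . i gamma' and
   W^2 = rho^2 |gamma'|^2 + p^2.  Then X_u x X_v has norm W and the mean curvature
   is h = rho ((rho^2 + |gamma|^2) k - q |gamma'|^2) / W^3, independent of v.  Since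
   (q / W)' = p h / rho, the left-hand side of the equation has derivative
   2 pi rho p (h - H), so it is constant iff p = 0 or h = H at each point.

   It remains to exclude circular arcs with h <> H.  On an open set where p = 0 one
   has h |gamma|^2 = rho q / W with q / W and |gamma| locally constant, so h is
   locally constant there.  If h(u0) <> H, the set where h = h(u0) and
   |gamma| = |gamma(u0)| is therefore open as well as closed, hence is all of R and
   gamma is circular. *)

Require Import Defs.
From Stdlib Require Import Reals Lra Classical.
From Coquelicot Require Import Coquelicot.

Open Scope R_scope.

(** * Scalar invariants of the profile curve *)

Definition radial (gamma : R -> C) (u : R) : R := dot (deriv gamma u) (gamma u).

(** In polar coordinates this is r^2 times the angular velocity, while [radial] is r times r'. *)
Definition angular (gamma : R -> C) (u : R) : R :=
  dot (deriv gamma u) (Ci * gamma u)%C.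

Definition area_density (rho : R) (gamma : R -> C) (u : R) : R :=
  sqrt (rho ^ 2 * Cmod (deriv gamma u) ^ 2 + (dot (deriv gamma u) (gamma u)) ^ 2).

(** The determinant of gamma' and gamma'', that is, the signed curvature of the plane curve times
    |gamma'|^3. *)
Definition planar_bending (gamma : R -> C) (u : R) : R :=
  dot (deriv (deriv gamma) u) (Ci * deriv gamma u)%C.

(** The closed form that [generated_surface_mean_curvature] identifies with the mean curvature along
    the orbit of [gamma u]. *)
Definition profile_curvature (rho : R) (gamma : R -> C) (u : R) : R :=
  rho * ((rho ^ 2 + Cmod (gamma u) ^ 2) * planar_bending gamma u
         - angular gamma u * Cmod (deriv gamma u) ^ 2)
  / area_density rho gamma u ^ 3.

(** * Componentwise calculus for complex-valued functions of a real variable *)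

Lemma Cmod_sqr (z : C) : Cmod z ^ 2 = Re z ^ 2 + Im z ^ 2.
Proof.
  unfold Cmod. rewrite pow2_sqrt; [reflexivity|].
  apply Rplus_le_le_0_compat; apply pow2_ge_0.
Qed.

Lemma dot_self (z : C) : dot z z = Cmod z ^ 2.
Proof. rewrite Cmod_sqr. unfold dot. ring. Qed.

Lemma of_class_C2_derive (f : R -> R) :
  of_class_C2 f ->
  (forall t, is_derive f t (Derive f t)) /\
  (forall t, is_derive (Derive f) t (Derive (Derive f) t)) /\
  (forall t, continuous (Derive (Derive f)) t).
Proof.
  intros Hf. refine (conj _ (conj _ _)); intros t; destruct (Hf t) as [Hd Hc].
  - apply Derive_correct. apply (Hd 1%nat). auto.
  - apply Derive_correct. apply (Hd 2%nat). auto.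
  - exact Hc.
Qed.

(** Relational companion of the total function [deriv]: it carries differentiability along, so that
    product rules compose, and [is_cderive_unique] returns to [deriv] at the end. *)
Definition is_cderive (f : R -> C) (t : R) (l : C) : Prop :=
  is_derive (fun s => Re (f s)) t (Re l) /\ is_derive (fun s => Im (f s)) t (Im l).

Lemma is_cderive_unique (f : R -> C) (t : R) (l : C) :
  is_cderive f t l -> deriv f t = l.
Proof.
  intros [Ha Hb]. rewrite (surjective_pairing l). unfold deriv.
  f_equal; now apply is_derive_unique.
Qed.

Lemma is_cderive_ext (f g : R -> C) (t : R) (l : C) :
  (forall s, f s = g s) -> is_cderive f t l -> is_cderive g t l.
Proof.
  intros E [Ha Hb]. split; [apply is_derive_ext with (2 := Ha)|apply is_derive_ext with (2 := Hb)];
    intros s; now rewrite E.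
Qed.

Lemma is_cderive_const (z : C) (t : R) : is_cderive (fun _ => z) t (RtoC 0).
Proof. exact (conj (is_derive_const (Re z) t) (is_derive_const (Im z) t)). Qed.

Lemma is_cderive_RtoC (f : R -> R) (t l : R) :
  is_derive f t l -> is_cderive (fun s => RtoC (f s)) t (RtoC l).
Proof. intros Hf. exact (conj Hf (is_derive_const 0 t)). Qed.

Lemma is_cderive_expi (t : R) : is_cderive expi t (Ci * expi t)%C.
Proof. split; simpl; auto_derive; trivial; ring. Qed.

Lemma is_cderive_opp (f : R -> C) (t : R) (l : C) :
  is_cderive f t l -> is_cderive (fun s => - f s)%C t (- l)%C.
Proof.
  intros [Ha Hb]. split; [exact (is_derive_opp _ _ _ Ha)|exact (is_derive_opp _ _ _ Hb)].
Qed.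

Lemma is_derive_Rmult (f g : R -> R) (t a b : R) :
  is_derive f t a -> is_derive g t b ->
  is_derive (fun s => f s * g s) t (a * g t + f t * b).
Proof. intros Hf Hg. apply (is_derive_mult f g t a b Hf Hg). intros; apply Rmult_comm. Qed.

Lemma is_cderive_mult (f g : R -> C) (t : R) (a b : C) :
  is_cderive f t a -> is_cderive g t b ->
  is_cderive (fun s => f s * g s)%C t (a * g t + f t * b)%C.
Proof.
  intros [Hf1 Hf2] [Hg1 Hg2]. split.
  - evar_last.
    + exact (is_derive_minus _ _ _ _ _ (is_derive_Rmult _ _ _ _ _ Hf1 Hg1)
                                       (is_derive_Rmult _ _ _ _ _ Hf2 Hg2)).
    + unfold minus, plus, opp, Re, Im. simpl. ring.
  - evar_last.
    + exact (is_derive_plus _ _ _ _ _ (is_derive_Rmult _ _ _ _ _ Hf1 Hg2)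
                                      (is_derive_Rmult _ _ _ _ _ Hf2 Hg1)).
    + unfold plus, Re, Im. simpl. ring.
Qed.

Lemma is_cderive_mult_l (z : C) (f : R -> C) (t : R) (l : C) :
  is_cderive f t l -> is_cderive (fun s => z * f s)%C t (z * l)%C.
Proof.
  intros Hf. replace (z * l)%C with (RtoC 0 * f t + z * l)%C by ring.
  exact (is_cderive_mult _ _ _ _ _ (is_cderive_const z t) Hf).
Qed.

Lemma is_cderive_mult_r (f : R -> C) (z : C) (t : R) (l : C) :
  is_cderive f t l -> is_cderive (fun s => f s * z)%C t (l * z)%C.
Proof.
  intros Hf. replace (l * z)%C with (l * z + f t * RtoC 0)%C by ring.
  exact (is_cderive_mult _ _ _ _ _ Hf (is_cderive_const z t)).
Qed.

Lemma is_derive_dot (f g : R -> C) (t : R) (a b : C) :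
  is_cderive f t a -> is_cderive g t b ->
  is_derive (fun s => dot (f s) (g s)) t (dot a (g t) + dot (f t) b).
Proof.
  intros [Hf1 Hf2] [Hg1 Hg2]. evar_last.
  - exact (is_derive_plus _ _ _ _ _ (is_derive_Rmult _ _ _ _ _ Hf1 Hg1)
                                    (is_derive_Rmult _ _ _ _ _ Hf2 Hg2)).
  - unfold plus, dot, Re, Im. simpl. ring.
Qed.

(** * Derivatives and continuity of the profile invariants *)

Lemma immersed_derive (gamma : R -> C) (u : R) :
  immersed gamma ->
  is_cderive gamma u (deriv gamma u) /\
  is_cderive (deriv gamma) u (deriv (deriv gamma) u) /\
  continuous (fun s => Re (deriv (deriv gamma) s)) u /\
  continuous (fun s => Im (deriv (deriv gamma) s)) u.
Proof.
  intros [Hx [Hy _]].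
  apply of_class_C2_derive in Hx. apply of_class_C2_derive in Hy.
  destruct Hx as [Hx1 [Hx2 Hx3]]. destruct Hy as [Hy1 [Hy2 Hy3]].
  exact (conj (conj (Hx1 u) (Hy1 u)) (conj (conj (Hx2 u) (Hy2 u)) (conj (Hx3 u) (Hy3 u)))).
Qed.

Lemma immersed_speed_pos (gamma : R -> C) (u : R) :
  immersed gamma -> 0 < Cmod (deriv gamma u) ^ 2.
Proof.
  intros [_ [_ H]]. apply pow_lt. apply Cmod_gt_0. apply H.
Qed.

Lemma area_density_sqr (rho : R) (gamma : R -> C) (u : R) :
  area_density rho gamma u ^ 2
  = rho ^ 2 * Cmod (deriv gamma u) ^ 2 + radial gamma u ^ 2.
Proof.
  apply pow2_sqrt. apply Rplus_le_le_0_compat; [|apply pow2_ge_0].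
  apply Rmult_le_pos; apply pow2_ge_0.
Qed.

Lemma area_density_pos (rho : R) (gamma : R -> C) (u : R) :
  0 < rho -> immersed gamma -> 0 < area_density rho gamma u.
Proof.
  intros Hr Hg. apply sqrt_lt_R0.
  apply Rplus_lt_le_0_compat; [|apply pow2_ge_0].
  apply Rmult_lt_0_compat; [now apply pow_lt|now apply immersed_speed_pos].
Qed.

Lemma is_derive_radial (gamma : R -> C) (u : R) :
  immersed gamma ->
  is_derive (radial gamma) u
    (dot (deriv (deriv gamma) u) (gamma u) + Cmod (deriv gamma u) ^ 2).
Proof.
  intros Hg. destruct (immersed_derive gamma u Hg) as [H1 [H2 _]].
  rewrite <- (dot_self (deriv gamma u)). now apply is_derive_dot.
Qed.

Lemma is_derive_Cmod_sqr (gamma : R -> C) (u : R) :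
  immersed gamma ->
  is_derive (fun s => Cmod (gamma s) ^ 2) u (2 * radial gamma u).
Proof.
  intros Hg. destruct (immersed_derive gamma u Hg) as [H1 _].
  apply (is_derive_ext (fun s => dot (gamma s) (gamma s))); [intros t; apply dot_self|].
  evar_last; [apply is_derive_dot; exact H1|]. unfold radial, dot. ring.
Qed.

Lemma is_derive_angular (gamma : R -> C) (u : R) :
  immersed gamma ->
  is_derive (angular gamma) u (dot (deriv (deriv gamma) u) (Ci * gamma u)%C).
Proof.
  intros Hg. destruct (immersed_derive gamma u Hg) as [H1 [H2 _]].
  evar_last.
  - apply is_derive_dot; [exact H2|].
    apply is_cderive_mult; [apply is_cderive_const|exact H1].
  - unfold dot. simpl. ring.
Qed.

Lemma is_derive_sqrt_quadratic (k : R) (f g : R -> R) (t a b : R) :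
  is_derive f t a -> is_derive g t b -> 0 < k * f t + g t ^ 2 ->
  is_derive (fun s => sqrt (k * f s + g s ^ 2)) t
    ((k * a + 2 * g t * b) / (2 * sqrt (k * f t + g t ^ 2))).
Proof.
  intros Hf Hg Hpos. auto_derive.
  - repeat split; try (eexists; eassumption). exact Hpos.
  - change (Derive (fun x => f x) t) with (Derive f t).
    change (Derive (fun x => g x) t) with (Derive g t).
    rewrite (is_derive_unique _ _ _ Hf), (is_derive_unique _ _ _ Hg).
    apply sqrt_lt_R0 in Hpos. simpl in *. field. lra.
Qed.

Lemma is_derive_area_density (rho : R) (gamma : R -> C) (u : R) :
  0 < rho -> immersed gamma ->
  is_derive (area_density rho gamma) u
    ((rho ^ 2 * dot (deriv (deriv gamma) u) (deriv gamma u)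
      + radial gamma u * (dot (deriv (deriv gamma) u) (gamma u)
                          + Cmod (deriv gamma u) ^ 2))
     / area_density rho gamma u).
Proof.
  intros Hr Hg. destruct (immersed_derive gamma u Hg) as [_ [H2 _]].
  assert (Hp := is_derive_radial gamma u Hg).
  assert (HW := area_density_pos rho gamma u Hr Hg).
  assert (HE := is_derive_dot _ _ _ _ _ H2 H2).
  (* [Cmod] is itself a square root, so the radicand is rewritten with [dot], which is polynomial in
     the components. *)
  assert (HS : forall s, sqrt (rho ^ 2 * dot (deriv gamma s) (deriv gamma s) + radial gamma s ^ 2)
                         = area_density rho gamma s).
  { intros s. now rewrite dot_self. }
  apply (is_derive_ext _ _ _ _ HS). rewrite <- HS in HW |- *. evar_last.
  - apply (is_derive_sqrt_quadratic (rho ^ 2) _ _ _ _ _ HE Hp).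
    rewrite dot_self, <- area_density_sqr. apply pow_lt.
    now apply area_density_pos.
  - unfold dot in *. field. lra.
Qed.

(** This identity is the source of the first integral. Writing q for [angular] and W for
    [area_density], the quotient rule gives (q' W^2 - q W W') / W^3. Both W^2 and W W' are
    polynomial in the components of gamma and its derivatives, and the numerator has [radial] as a
    factor. *)
Lemma is_derive_angular_ratio (rho : R) (gamma : R -> C) (u : R) :
  0 < rho -> immersed gamma ->
  is_derive (fun s => angular gamma s / area_density rho gamma s) u
    (radial gamma u * profile_curvature rho gamma u / rho).
Proof.
  intros Hr Hg.
  assert (HW := area_density_pos rho gamma u Hr Hg).
  assert (HQ := area_density_sqr rho gamma u).
  evar_last.
  { apply is_derive_div; [now apply is_derive_angular|now apply is_derive_area_density|lra]. }
  unfold profile_curvature.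
  set (W := area_density rho gamma u) in *.
  assert (K : dot (deriv (deriv gamma) u) (Ci * gamma u)%C * W ^ 2
    - angular gamma u * (rho ^ 2 * dot (deriv (deriv gamma) u) (deriv gamma u)
      + radial gamma u * (dot (deriv (deriv gamma) u) (gamma u)
                          + Cmod (deriv gamma u) ^ 2))
    = radial gamma u * ((rho ^ 2 + Cmod (gamma u) ^ 2) * planar_bending gamma u
         - angular gamma u * Cmod (deriv gamma u) ^ 2)).
  { rewrite HQ, !Cmod_sqr. unfold radial, angular, planar_bending, dot, Re, Im. simpl. ring. }
  transitivity ((dot (deriv (deriv gamma) u) (Ci * gamma u)%C * W ^ 2
    - angular gamma u * (rho ^ 2 * dot (deriv (deriv gamma) u) (deriv gamma u)
      + radial gamma u * (dot (deriv (deriv gamma) u) (gamma u)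
                          + Cmod (deriv gamma u) ^ 2))) / W ^ 3).
  - field. lra.
  - rewrite K. field. lra.
Qed.

Lemma continuous_dot (f g : R -> C) (t : R) :
  continuous (fun s => Re (f s)) t -> continuous (fun s => Im (f s)) t ->
  continuous (fun s => Re (g s)) t -> continuous (fun s => Im (g s)) t ->
  continuous (fun s => dot (f s) (g s)) t.
Proof.
  intros Hf1 Hf2 Hg1 Hg2.
  exact (continuous_plus _ _ _ (continuous_mult _ _ _ Hf1 Hg1) (continuous_mult _ _ _ Hf2 Hg2)).
Qed.

Lemma is_derive_continuous (f : R -> R) (t l : R) : is_derive f t l -> continuous f t.
Proof. intros Hf. apply (ex_derive_continuous f). now exists l. Qed.

(** Second derivatives enter only through [planar_bending]; this is where their continuity is
    used. *)
Lemma continuous_profile_curvature (rho : R) (gamma : R -> C) (u : R) :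
  0 < rho -> immersed gamma -> continuous (profile_curvature rho gamma) u.
Proof.
  intros Hr Hg. destruct (immersed_derive gamma u Hg) as [H1 [H2 [H3 H4]]].
  assert (HW := area_density_pos rho gamma u Hr Hg).
  assert (cr := is_derive_continuous _ _ _ (is_derive_Cmod_sqr gamma u Hg)).
  assert (cq := is_derive_continuous _ _ _ (is_derive_angular gamma u Hg)).
  assert (cE : continuous (fun s => Cmod (deriv gamma s) ^ 2) u).
  { apply (continuous_ext (fun s => dot (deriv gamma s) (deriv gamma s)));
      [intros s; apply dot_self|].
    eapply is_derive_continuous. apply is_derive_dot; exact H2. }
  destruct (is_cderive_mult _ _ _ _ _ (is_cderive_const Ci u) H2) as [cI1 cI2].
  assert (ck : continuous (planar_bending gamma) u).
  { exact (continuous_dot _ _ _ H3 H4 (is_derive_continuous _ _ _ cI1)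
                                      (is_derive_continuous _ _ _ cI2)). }
  assert (cW := is_derive_continuous _ _ _ (is_derive_area_density rho gamma u Hr Hg)).
  assert (cV : continuous (fun s => / area_density rho gamma s ^ 3) u).
  { apply (continuous_comp (fun s => area_density rho gamma s ^ 3) Rinv).
    (* The cube unfolds to W * (W * (W * 1)), which explains the constant factor 1. *)
    - exact (continuous_mult _ _ _ cW (continuous_mult _ _ _ cW
               (continuous_mult _ _ _ cW (continuous_const 1 u)))).
    - apply continuous_Rinv. apply pow_nonzero. lra. }
  exact (continuous_mult _ _ _
    (continuous_mult _ _ _ (continuous_const rho u)
      (continuous_minus _ _ _
        (continuous_mult _ _ _ (continuous_plus _ _ _ (continuous_const (rho ^ 2) u) cr) ck)
        (continuous_mult _ _ _ cq cE))) cV).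
Qed.

(** * Tangent frame, unit normal and mean curvature of the generated surface *)

Lemma generated_surface_screw (rho : R) (gamma : R -> C) (t u v : R) :
  screw t (generated_surface rho gamma u v) = generated_surface rho gamma u (v + t).
Proof.
  unfold screw, generated_surface. simpl.
  assert (E : expi (v + t) = (expi t * expi v)%C).
  { unfold expi, Cmult. simpl. rewrite cos_plus, sin_plus. f_equal; ring. }
  rewrite E. f_equal; ring.
Qed.

Lemma generated_surface_helicoidal (rho : R) (gamma : R -> C) :
  0 < rho -> helicoidal rho (generated_surface rho gamma).
Proof.
  intros Hr. split.
  - intros u v. unfold generated_surface. simpl.
    rewrite Cmod_mult, Cmod_R, Rabs_pos_eq by lra.
    unfold Cmod, expi. simpl fst. simpl snd.
    replace (cos v ^ 2 + sin v ^ 2) with 1.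
    + rewrite sqrt_1. ring.
    + rewrite <- (sin2_cos2 v). unfold Rsqr. ring.
  - intros t u v. exists u, (v + t). apply generated_surface_screw.
Qed.

Lemma generated_surface_pd_u (rho : R) (gamma : R -> C) (u v : R) :
  immersed gamma ->
  pd_u (generated_surface rho gamma) u v = ((expi v * deriv gamma u)%C, RtoC 0).
Proof.
  intros Hg. destruct (immersed_derive gamma u Hg) as [H1 _].
  unfold pd_u. simpl. f_equal; apply is_cderive_unique; [|apply is_cderive_const].
  now apply is_cderive_mult_l.
Qed.

Lemma generated_surface_pd_v (rho : R) (gamma : R -> C) (u v : R) :
  pd_v (generated_surface rho gamma) u v
  = ((Ci * expi v * gamma u)%C, (RtoC rho * (Ci * expi v))%C).
Proof.
  unfold pd_v. simpl. f_equal; apply is_cderive_unique.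
  - apply is_cderive_mult_r. apply is_cderive_expi.
  - apply is_cderive_mult_l. apply is_cderive_expi.
Qed.

Lemma circle_tangent_expi (rho v : R) (z : C) :
  0 < rho -> circle_tangent rho (z, (RtoC rho * expi v)%C) = (Ci * expi v)%C.
Proof.
  intros Hr. unfold circle_tangent. simpl snd. field.
  intros E. apply RtoC_inj in E. lra.
Qed.

(** Both components depend on v only through the factor i e^(iv), because the screw motions are
    isometries. The length of the cross product is [area_density], free of v. *)
Lemma generated_surface_unit_normal (rho : R) (gamma : R -> C) (u v : R) :
  0 < rho -> immersed gamma ->
  unit_normal rho (generated_surface rho gamma) u v
  = ((- (RtoC (rho / area_density rho gamma u) * (Ci * expi v * deriv gamma u)))%C,
     (RtoC (radial gamma u / area_density rho gamma u) * (Ci * expi v))%C).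
Proof.
  intros Hr Hg. unfold unit_normal.
  rewrite generated_surface_pd_u, generated_surface_pd_v by assumption.
  set (N := cross _ _ _ _).
  (* Oriented as a rewrite rule, so that [ring [SC]] reduces polynomials in cos v and sin v modulo
     the circle relation. *)
  assert (SC : sin v ^ 2 = 1 - cos v ^ 2).
  { generalize (sin2_cos2 v). unfold Rsqr. lra. }
  assert (EN : N = ((- (RtoC rho * (Ci * expi v * deriv gamma u)))%C,
     (RtoC (radial gamma u) * (Ci * expi v))%C)).
  { unfold N, cross, generated_surface. rewrite circle_tangent_expi by assumption.
    unfold radial, dot, Re, Im. simpl. unfold Cmult, Copp, RtoC. simpl.
    f_equal; f_equal; ring [SC]. }
  assert (EI : inner N N = rho ^ 2 * Cmod (deriv gamma u) ^ 2
                 + (dot (deriv gamma u) (gamma u)) ^ 2).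
  { fold (radial gamma u). rewrite EN, Cmod_sqr. unfold inner, dot, Re, Im. simpl. ring [SC]. }
  rewrite EI, EN. fold (area_density rho gamma u).
  unfold scal2. simpl. unfold Rdiv. rewrite !RtoC_mult. f_equal; ring.
Qed.

(** The derivative [W'] of 1 / [area_density] is kept abstract. Its terms add up to [W'] times the
    unnormalized normal, which is orthogonal to the surface, so they vanish in every inner product
    with a tangent vector. *)
Lemma unit_normal_pd_u (rho : R) (gamma : R -> C) (u v W' : R) :
  0 < rho -> immersed gamma -> is_derive (fun s => / area_density rho gamma s) u W' ->
  pd_u (unit_normal rho (generated_surface rho gamma)) u v
  = ((- (RtoC (rho * W') * (Ci * expi v * deriv gamma u)
         + RtoC (rho / area_density rho gamma u) * (Ci * expi v * deriv (deriv gamma) u)))%C,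
     (RtoC ((dot (deriv (deriv gamma) u) (gamma u) + Cmod (deriv gamma u) ^ 2)
            * / area_density rho gamma u + radial gamma u * W') * (Ci * expi v))%C).
Proof.
  intros Hr Hg HI. destruct (immersed_derive gamma u Hg) as [_ [H2 _]].
  unfold pd_u. f_equal; apply is_cderive_unique.
  - apply (is_cderive_ext (fun s => - (RtoC (rho / area_density rho gamma s) * (Ci * expi v * deriv gamma s)))%C).
    { intros s. now rewrite generated_surface_unit_normal by assumption. }
    apply is_cderive_opp.
    apply (is_cderive_mult (fun s => RtoC (rho / area_density rho gamma s))
                           (fun s => Ci * expi v * deriv gamma s)%C).
    + apply is_cderive_RtoC. exact (is_derive_scal _ _ rho _ HI).
    + now apply is_cderive_mult_l.
  - apply (is_cderive_ext (fun s => RtoC (radial gamma s / area_density rho gamma s) * (Ci * expi v))%C).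
    { intros s. now rewrite generated_surface_unit_normal by assumption. }
    apply (is_cderive_mult_r (fun s => RtoC (radial gamma s / area_density rho gamma s))).
    apply is_cderive_RtoC.
    exact (is_derive_Rmult _ _ _ _ _ (is_derive_radial gamma u Hg) HI).
Qed.

Lemma unit_normal_pd_v (rho : R) (gamma : R -> C) (u v : R) :
  0 < rho -> immersed gamma ->
  pd_v (unit_normal rho (generated_surface rho gamma)) u v
  = ((- (RtoC (rho / area_density rho gamma u) * (Ci * (Ci * expi v) * deriv gamma u)))%C,
     (RtoC (radial gamma u / area_density rho gamma u) * (Ci * (Ci * expi v)))%C).
Proof.
  intros Hr Hg. unfold pd_v. f_equal; apply is_cderive_unique.
  - apply (is_cderive_ext (fun s => - (RtoC (rho / area_density rho gamma u) * (Ci * expi s * deriv gamma u)))%C).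
    { intros s. now rewrite generated_surface_unit_normal by assumption. }
    apply is_cderive_opp, is_cderive_mult_l, is_cderive_mult_r, is_cderive_mult_l,
      is_cderive_expi.
  - apply (is_cderive_ext (fun s => RtoC (radial gamma u / area_density rho gamma u) * (Ci * expi s))%C).
    { intros s. now rewrite generated_surface_unit_normal by assumption. }
    apply is_cderive_mult_l, is_cderive_mult_l, is_cderive_expi.
Qed.

(** The first fundamental form is E = |gamma'|^2, F = q, G = rho^2 + |gamma|^2, and the second is
    rho / W times (k, |gamma'|^2, q). In the trace, the two mixed terms contribute -2 q |gamma'|^2
    and the last one + q |gamma'|^2, leaving the single term of [profile_curvature]. *)
Lemma generated_surface_mean_curvature (rho : R) (gamma : R -> C) (u v : R) :
  0 < rho -> immersed gamma ->
  mean_curvature rho (generated_surface rho gamma) u v = profile_curvature rho gamma u.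
Proof.
  intros Hr Hg.
  assert (HW := area_density_pos rho gamma u Hr Hg).
  assert (HQ := area_density_sqr rho gamma u).
  assert (HD := is_derive_area_density rho gamma u Hr Hg).
  apply is_derive_inv in HD; [|lra].
  unfold mean_curvature.
  rewrite generated_surface_pd_u, generated_surface_pd_v, unit_normal_pd_v,
    (unit_normal_pd_u rho gamma u v _ Hr Hg HD) by assumption.
  set (W' := - _ / _). clearbody W'. clear HD.
  unfold profile_curvature.
  set (W := area_density rho gamma u) in *. clearbody W.
  set (Xu := (_, RtoC 0)). set (Xv := (_, (RtoC rho * (Ci * expi v))%C)).
  set (nu_v := ((- (_ * (Ci * (Ci * expi v) * _)))%C, _)). set (nu_u := (_, _)).
  assert (SC : sin v ^ 2 = 1 - cos v ^ 2).
  { generalize (sin2_cos2 v). unfold Rsqr. lra. }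
  assert (Euu : inner Xu Xu = Cmod (deriv gamma u) ^ 2).
  { rewrite Cmod_sqr. unfold Xu, inner, dot, Re, Im. simpl. ring [SC]. }
  assert (Euv : inner Xu Xv = angular gamma u).
  { unfold Xu, Xv, inner, angular, dot, Re, Im. simpl. ring [SC]. }
  assert (Evv : inner Xv Xv = rho ^ 2 + Cmod (gamma u) ^ 2).
  { rewrite Cmod_sqr. unfold Xv, inner, dot, Re, Im. simpl. ring [SC]. }
  assert (Nuu : inner nu_u Xu = rho * planar_bending gamma u / W).
  { unfold nu_u, Xu, inner, planar_bending, dot, Re, Im, Rdiv. simpl. ring [SC]. }
  assert (Nuv : inner nu_u Xv = rho * Cmod (deriv gamma u) ^ 2 / W).
  { unfold nu_u, Xv, inner, radial. rewrite Cmod_sqr. unfold dot, Re, Im, Rdiv. simpl.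
    ring [SC]. }
  assert (Nvu : inner nu_v Xu = rho * Cmod (deriv gamma u) ^ 2 / W).
  { rewrite Cmod_sqr. unfold nu_v, Xu, inner, dot, Re, Im, Rdiv. simpl. ring [SC]. }
  assert (Nvv : inner nu_v Xv = rho * angular gamma u / W).
  { unfold nu_v, Xv, inner, angular, dot, Re, Im, Rdiv. simpl. ring [SC]. }
  rewrite Euu, Euv, Evv, Nuu, Nuv, Nvu, Nvv.
  (* E G - F^2 = W^2 by Lagrange's identity |gamma'|^2 |gamma|^2 = p^2 + q^2. *)
  assert (ED : Cmod (deriv gamma u) ^ 2 * (rho ^ 2 + Cmod (gamma u) ^ 2) - angular gamma u ^ 2
    = W ^ 2).
  { rewrite HQ, !Cmod_sqr. unfold angular, radial, dot, Re, Im. simpl. ring. }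
  rewrite ED. field. lra.
Qed.

(* Where the radial speed vanishes to first order, the curve osculates a circle
   about the origin. *)
Lemma profile_curvature_osculating (rho : R) (gamma : R -> C) (u : R) :
  0 < rho -> immersed gamma -> radial gamma u = 0 ->
  dot (deriv (deriv gamma) u) (gamma u) + Cmod (deriv gamma u) ^ 2 = 0 ->
  profile_curvature rho gamma u * Cmod (gamma u) ^ 2
  = rho * (angular gamma u / area_density rho gamma u).
Proof.
  intros Hr Hg Hp Hp'.
  assert (HW := area_density_pos rho gamma u Hr Hg).
  assert (HQ := area_density_sqr rho gamma u).
  unfold profile_curvature.
  set (W := area_density rho gamma u) in *. clearbody W.
  assert (Hk : Cmod (gamma u) ^ 2 * planar_bending gamma u
               = angular gamma u * Cmod (deriv gamma u) ^ 2).
  (* Expansion of gamma'' in the orthogonal frame gamma, i gamma, paired with i gamma'. *)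
  { transitivity (radial gamma u * dot (deriv (deriv gamma) u) (Ci * gamma u)%C
      - angular gamma u * dot (deriv (deriv gamma) u) (gamma u)).
    - rewrite Cmod_sqr. unfold planar_bending, radial, angular, dot, Re, Im. simpl. ring.
    - rewrite Hp. replace (dot (deriv (deriv gamma) u) (gamma u))
        with (- Cmod (deriv gamma u) ^ 2) by lra. ring. }
  rewrite Hp in HQ.
  (* With vanishing radial speed, W^2 = rho^2 |gamma'|^2, which cancels two of the three powers of
     W. *)
  transitivity (rho * (angular gamma u * (rho ^ 2 * Cmod (deriv gamma u) ^ 2)) / W ^ 3).
  - replace (angular gamma u * (rho ^ 2 * Cmod (deriv gamma u) ^ 2))
      with (rho ^ 2 * (Cmod (gamma u) ^ 2 * planar_bending gamma u))
      by (rewrite Hk; ring).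
    replace ((rho ^ 2 + Cmod (gamma u) ^ 2) * planar_bending gamma u
         - angular gamma u * Cmod (deriv gamma u) ^ 2)
      with (rho ^ 2 * planar_bending gamma u) by (rewrite <- Hk; ring).
    field. lra.
  - replace (rho ^ 2 * Cmod (deriv gamma u) ^ 2) with (W ^ 2) by (rewrite HQ; ring).
    field. lra.
Qed.

(** * Locally constant functions and connectedness of the line *)

Lemma derive_zero_eq (f : R -> R) (s t : R) :
  (forall x, Rmin s t <= x <= Rmax s t -> is_derive f x 0) -> f s = f t.
Proof.
  intros Hf. destruct (MVT_gen f s t (fun _ => 0)) as [c [_ Hc]].
  - intros x Hx. apply Hf. lra.
  - intros x Hx. apply continuity_pt_filterlim.
    exact (is_derive_continuous f x 0 (Hf x Hx)).
  - lra.
Qed.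

Lemma derive_zero_locally_eq (f : R -> R) (t : R) :
  locally t (fun x => is_derive f x 0) -> locally t (fun s => f s = f t).
Proof.
  intros [e He]. exists e. intros s Hs. apply derive_zero_eq. intros x Hx. apply He.
  change (Rabs (s - t) < e) in Hs. change (Rabs (x - t) < e).
  apply Rabs_def2 in Hs. revert Hx. unfold Rmin, Rmax.
  destruct (Rle_dec s t); intros; apply Rabs_def1; lra.
Qed.

Lemma continuous_locally_neq (f : R -> R) (t c : R) :
  continuous f t -> f t <> c -> locally t (fun s => f s <> c).
Proof.
  intros Hf Hc. exact (Hf _ (open_neq c (f t) Hc)).
Qed.

Lemma locally_zero_everywhere_zero (f : R -> R) (t0 : R) :
  (forall t, continuous f t) ->
  (forall t, f t = 0 -> locally t (fun s => f s = 0)) ->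
  f t0 = 0 -> forall t, f t = 0.
Proof.
  intros Hc Hz H0 t.
  (* Connectedness of the line: the indicator function of the zero set has zero
     derivative. *)
  set (g := fun s => if Req_EM_T (f s) 0 then 1 else 0).
  assert (Hg : forall s, is_derive g s 0).
  { intros s. destruct (Req_dec (f s) 0) as [E|E].
    - apply (is_derive_ext_loc (fun _ => 1)); [|exact (is_derive_const 1 s)].
      apply (filter_imp (fun r => f r = 0)); [|now apply Hz].
      intros r Hr. unfold g. now destruct (Req_EM_T (f r) 0).
    - apply (is_derive_ext_loc (fun _ => 0)); [|exact (is_derive_const 0 s)].
      apply (filter_imp (fun r => f r <> 0)); [|now apply continuous_locally_neq].
      intros r Hr. unfold g. now destruct (Req_EM_T (f r) 0). }
  generalize (derive_zero_eq g t t0 (fun x _ => Hg x)). unfold g.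
  destruct (Req_EM_T (f t) 0); destruct (Req_EM_T (f t0) 0); try lra; tauto.
Qed.

(** * The first integral and the exclusion of circular arcs *)

Definition first_integral (rho H : R) (gamma : R -> C) (u : R) : R :=
  2 * PI * rho ^ 2 * angular gamma u / area_density rho gamma u
  - PI * rho * H * Cmod (gamma u) ^ 2.

Lemma is_derive_first_integral (rho H : R) (gamma : R -> C) (u : R) :
  0 < rho -> immersed gamma ->
  is_derive (first_integral rho H gamma) u
    (2 * PI * rho * radial gamma u * (profile_curvature rho gamma u - H)).
Proof.
  intros Hr Hg.
  apply (is_derive_ext (fun s => 2 * PI * rho ^ 2 * (angular gamma s / area_density rho gamma s)
                                 - PI * rho * H * Cmod (gamma s) ^ 2)).
  { intros s. unfold first_integral, Rdiv. now rewrite (Rmult_assoc (2 * PI * rho ^ 2)). }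
  evar_last.
  - exact (is_derive_minus _ _ _ _ _
      (is_derive_scal _ _ (2 * PI * rho ^ 2) _ (is_derive_angular_ratio rho gamma u Hr Hg))
      (is_derive_scal _ _ (PI * rho * H) _ (is_derive_Cmod_sqr gamma u Hg))).
  - unfold minus, plus, opp. simpl. field. lra.
Qed.

(** The alternative is only pointwise: where [radial] vanishes the curvature is left free, and which
    case holds may vary with u. [circular_dichotomy] makes it global. *)
Lemma first_integral_constant_iff (rho H : R) (gamma : R -> C) :
  0 < rho -> immersed gamma ->
  (exists c, forall u, first_integral rho H gamma u = c) <->
  (forall u, radial gamma u = 0 \/ profile_curvature rho gamma u = H).
Proof.
  intros Hr Hg. split.
  - intros [c Hc] u.
    assert (E : is_derive (first_integral rho H gamma) u 0).
    { apply (is_derive_ext (fun _ => c)); [now intros|exact (is_derive_const c u)]. }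
    apply is_derive_unique in E.
    rewrite (is_derive_unique _ _ _ (is_derive_first_integral rho H gamma u Hr Hg)) in E.
    assert (HP : 2 * PI * rho <> 0).
    { apply Rgt_not_eq. generalize PI_RGT_0. intros. apply Rmult_lt_0_compat; lra. }
    apply Rmult_integral in E as [E|E]; [|right; lra].
    apply Rmult_integral in E as [E|E]; [contradiction|now left].
  - intros HpH. exists (first_integral rho H gamma 0). intros u.
    apply derive_zero_eq. intros t _.
    evar_last; [now apply is_derive_first_integral|].
    destruct (HpH t) as [E|E]; rewrite E; ring.
Qed.

(** Near u, [profile_curvature_osculating] expresses h |gamma|^2 through [angular] / [area_density].
    That ratio and |gamma|^2 both have derivatives with the factor [radial], so they are locally
    constant; dividing by |gamma|^2 makes h locally constant. *)
Lemma locally_circular_profile_curvature (rho : R) (gamma : R -> C) (u : R) :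
  0 < rho -> immersed gamma -> locally u (fun s => radial gamma s = 0) ->
  locally u (fun s => Cmod (gamma s) ^ 2 = Cmod (gamma u) ^ 2 /\
                      profile_curvature rho gamma s = profile_curvature rho gamma u).
Proof.
  intros Hr Hg Hp.
  assert (Hp' : locally u (fun s =>
    dot (deriv (deriv gamma) s) (gamma s) + Cmod (deriv gamma s) ^ 2 = 0)).
  (* Each point s near u has its own neighbourhood on which [radial] is zero, so the derivative of
     [radial] vanishes at s as well. *)
  { apply locally_locally in Hp. apply filter_imp with (2 := Hp). intros s Hs.
    rewrite <- (is_derive_unique _ _ _ (is_derive_radial gamma s Hg)).
    apply is_derive_unique. apply (is_derive_ext_loc (fun _ => 0)).
    - apply filter_imp with (2 := Hs). now symmetry.
    - exact (is_derive_const 0 s). }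
  assert (Hn : locally u (fun s => Cmod (gamma s) ^ 2 = Cmod (gamma u) ^ 2)).
  { apply (derive_zero_locally_eq (fun s => Cmod (gamma s) ^ 2)).
    apply filter_imp with (2 := Hp). intros s Hs.
    evar_last; [now apply is_derive_Cmod_sqr|]. rewrite Hs. ring. }
  assert (Hq : locally u (fun s => angular gamma s / area_density rho gamma s
                                   = angular gamma u / area_density rho gamma u)).
  { apply (derive_zero_locally_eq (fun s => angular gamma s / area_density rho gamma s)).
    apply filter_imp with (2 := Hp). intros s Hs.
    evar_last; [now apply is_derive_angular_ratio|]. rewrite Hs. field. lra. }
  (* If gamma passed through the origin at u, the vanishing derivative of [radial] would reduce to
     |gamma'|^2 = 0, contradicting immersion. *)
  assert (Hne : Cmod (gamma u) ^ 2 <> 0).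
  { intros E. apply locally_singleton in Hp'.
    assert (Hs := immersed_speed_pos gamma u Hg).
    destruct (Req_dec (Cmod (gamma u)) 0) as [E0|E0]; [|now apply (pow_nonzero _ 2) in E0].
    apply Cmod_eq_0 in E0. rewrite E0 in Hp'. unfold dot in Hp'. simpl in Hp', Hs. lra. }
  assert (Hpu := locally_singleton _ _ Hp). assert (Hpu' := locally_singleton _ _ Hp').
  generalize (filter_and _ _ (filter_and _ _ Hp Hp') (filter_and _ _ Hn Hq)).
  apply filter_imp. intros s [[H1 H2] [H3 H4]]. split; [exact H3|].
  apply (Rmult_eq_reg_r (Cmod (gamma u) ^ 2)); [|exact Hne].
  (* Only the left side moves to |gamma s|^2, so that the osculating formula applies at s on the
     left and at u on the right. *)
  rewrite <- H3 at 1.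
  rewrite !profile_curvature_osculating by assumption. now rewrite H4.
Qed.

Lemma circular_dichotomy (rho H : R) (gamma : R -> C) :
  0 < rho -> immersed gamma ->
  (forall u, radial gamma u = 0 \/ profile_curvature rho gamma u = H) ->
  circular gamma \/ forall u, profile_curvature rho gamma u = H.
Proof.
  intros Hr Hg HpH.
  destruct (classic (circular gamma)) as [Hc|Hc]; [now left|right]. intros u0.
  destruct (Req_dec (profile_curvature rho gamma u0) H) as [E|E]; [exact E|].
  exfalso. apply Hc. exists (Cmod (gamma u0)).
  (* [f] vanishes exactly where both the curvature and the modulus of gamma agree
     with their values at u0; this set is open because the curvature there
     differs from H, which forces the radial speed to vanish nearby. *)
  set (f := fun t => (profile_curvature rho gamma t - profile_curvature rho gamma u0) ^ 2
                   + (Cmod (gamma t) ^ 2 - Cmod (gamma u0) ^ 2) ^ 2).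
  assert (Hf0 : forall t, f t = 0 <->
    profile_curvature rho gamma t = profile_curvature rho gamma u0 /\
    Cmod (gamma t) ^ 2 = Cmod (gamma u0) ^ 2).
  { intros t. unfold f. rewrite <- !Rsqr_pow2. split.
    - intros Ht. apply Rplus_sqr_eq_0 in Ht. lra.
    - intros [-> ->]. unfold Rsqr. ring. }
  assert (Hf : forall t, f t = 0).
  { apply locally_zero_everywhere_zero with u0; [| |now apply Hf0].
    - intros t.
      assert (C1 := continuous_minus _ _ _ (continuous_profile_curvature rho gamma t Hr Hg)
         (continuous_const (profile_curvature rho gamma u0) t)).
      assert (C2 := continuous_minus _ _ _
         (is_derive_continuous _ _ _ (is_derive_Cmod_sqr gamma t Hg))
         (continuous_const (Cmod (gamma u0) ^ 2) t)).
      exact (continuous_plus _ _ _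
        (continuous_mult _ _ _ C1 (continuous_mult _ _ _ C1 (continuous_const 1 t)))
        (continuous_mult _ _ _ C2 (continuous_mult _ _ _ C2 (continuous_const 1 t)))).
    - intros t Ht. apply Hf0 in Ht as [Ht1 Ht2].
      apply filter_imp with (P := fun s => Cmod (gamma s) ^ 2 = Cmod (gamma t) ^ 2 /\
                      profile_curvature rho gamma s = profile_curvature rho gamma t).
      + intros s [Hs1 Hs2]. apply Hf0. now rewrite Hs1, Hs2.
      + apply locally_circular_profile_curvature; [assumption..|].
        apply (filter_imp (fun s => profile_curvature rho gamma s <> H)).
        * intros s Hs. now destruct (HpH s).
        * apply continuous_locally_neq; [now apply continuous_profile_curvature|].
          now rewrite Ht1. }
  intros t. destruct (proj1 (Hf0 t) (Hf t)) as [_ Ht].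
  apply Rsqr_inj; [apply Cmod_ge_0..|]. now rewrite !Rsqr_pow2.
Qed.

Theorem proposition4p7 :
  forall (rho H : R) (gamma : R -> C),
    0 < rho ->
    immersed gamma ->
    ~ circular gamma ->
    (twizzler rho H (generated_surface rho gamma) <->
     exists c : R, forall u : R,
       2 * PI * rho ^ 2 * dot (deriv gamma u) (Ci * gamma u)%C
         / sqrt (rho ^ 2 * Cmod (deriv gamma u) ^ 2
                 + (dot (deriv gamma u) (gamma u)) ^ 2)
       - PI * rho * H * Cmod (gamma u) ^ 2 = c).
Proof.
  intros rho H gamma Hr Hg Hnc.
  (* [first_integral] is the left-hand side of the equation up to unfolding. *)
  change (twizzler rho H (generated_surface rho gamma) <->
          exists c, forall u, first_integral rho H gamma u = c).
  rewrite first_integral_constant_iff by assumption. split.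
  - intros [_ HH] u. right.
    (* The value v = 0 is arbitrary, since the mean curvature is constant along orbits. *)
    rewrite <- (generated_surface_mean_curvature rho gamma u 0) by assumption. apply HH.
  - intros HpH. split; [now apply generated_surface_helicoidal|]. intros u v.
    rewrite generated_surface_mean_curvature by assumption.
    destruct (circular_dichotomy rho H gamma Hr Hg HpH) as [Hc|Hh]; [contradiction|apply Hh].
Qed.
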